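(* Let $G$ be a connected graph and let $e\in E(G)$ be an edge such that $G-e$ is connected. Then $$\frac{1}{6}\,\mu_o(G)\le \mu_o(G-e)\le 2\,\mu_o(G)+1.$$
   Context: All graphs are finite, simple and connected. For a connected graph $G$ and $X\subseteq V(G)$, two vertices $u,v$ are $X$-visible if there is a shortest $u,v$-path $P$ in $G$ with $V(P)\cap X\subseteq\{u,v\}$. A set $X\subseteq V(G)$ is an outer mutual-visibility set if every two vertices $u,v$ with $u\in X$ and $v\in V(G)$ are $X$-visible; the outer mutual-visibility number $\mu_o(G)$ is the maximum cardinality of an outer mutual-visibility set in $G$. $G-e$ denotes the graph obtained by deleting the edge $e$. *)

(* Defs.v *)
From mathcomp Require Import all_boot all_order all_algebra.
From mathcomp Require Import boolp.

Set Implicit Arguments.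
Unset Strict Implicit.
Unset Printing Implicit Defensive.

Section Graphs.
Variable T : finType.
Implicit Types (adj : rel T) (X : {set T}) (u v : T) (p : seq T).

Definition connected_graph adj : Prop := forall u v, connect adj u v.

Definition del_edge adj (a b : T) : rel T :=
  [rel x y | adj x y && ([set x; y] != [set a; b])].

(* A path is given by its first vertex u and the sequence p of the remaining
   ones, so its vertex set is u :: p and its length is size p. *)
Definition uv_path adj u v p : Prop :=
  [/\ path adj u p, last u p = v & uniq (u :: p)].

Definition shortest_uv_path adj u v p : Prop :=
  uv_path adj u v p /\ forall q, uv_path adj u v q -> size p <= size q.

Definition visible adj X u v : Prop :=
  exists p, shortest_uv_path adj u v p /\
    [set w in u :: p] :&: X \subset [set u; v].

Definition outer_mutual_visibility_set adj X : Prop :=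
  forall u v, u \in X -> visible adj X u v.

Definition mu_o adj : nat :=
  \max_(X : {set T} | `[< outer_mutual_visibility_set adj X >]) #|X|.

End Graphs.

(* Main.v *)
Require Import Defs.
From mathcomp Require Import all_boot all_order all_algebra.
From mathcomp Require Import boolp zify.

Set Implicit Arguments.
Unset Strict Implicit.
Unset Printing Implicit Defensive.

(** Write d for the distance in G. A vertex is on the a-side if it is strictly
    closer to a than to b, on the b-side if strictly closer to b, and balanced
    otherwise. A geodesic of G uses the edge ab only if its ends lie on opposite
    strict sides, and a geodesic between b and a b-side vertex stays on the
    b-side.

    Upper bound: let X be an outer mutual-visibility set of G - ab. A vertex x on
    the a-side whose distance to v drops in G reaches v along an X-free path to
    a, the edge ab, and a path on the b-side. So the vertices of X other than a
    and not on the b-side form an outer mutual-visibility set of G, and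
    symmetrically. These two sets lose at most one vertex of X unless a and b
    are both in X; in that case X minus a and b works, since b itself sees every
    v in G - ab.

    Lower bound: let X be an outer mutual-visibility set of G. The balanced
    vertices of X form one for G - ab. The a-side vertices of X split into those
    with a (G - ab)-neighbour on the b-side, which reach every b-side vertex
    through that side at no extra cost, and those without. In the latter case
    follow a (G - ab)-geodesic from x to v up to where it leaves the a-side for
    good, through an edge wy: if y is balanced, use an X-free geodesic from x to
    y, otherwise one from x to w, and w is not in the set. This gives
    mu_o(G) <= 5 mu_o(G - ab). *)

(** * Distance, geodesics and visibility *)

Section Distance.
Variables (T : finType) (e : rel T).
Hypothesis e_conn : connected_graph e.
Implicit Types (u v w : T) (p q : seq T) (X Y : {set T}).

Definition walk_of_size u v n : bool :=
  `[< exists p, [/\ path e u p, last u p = v & size p = n] >].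

(** Minimising over all walks lets concatenations bound [dist] without a simplicity check. The
    default 0 is never taken in a connected graph. *)
Definition dist u v : nat :=
  if pselect (exists n, walk_of_size u v n) is left h then ex_minn h else 0.

Lemma dist_min u v p : path e u p -> last u p = v -> dist u v <= size p.
Proof.
move=> pp lp; have h : walk_of_size u v (size p) by apply/asboolP; exists p.
rewrite /dist; case: pselect => [h'|[]]; last by exists (size p).
by case: ex_minnP => m _; apply.
Qed.

Lemma geodesic u v :
  exists p, [/\ path e u p, last u p = v & size p = dist u v].
Proof.
rewrite /dist; case: pselect => [h|[]].
  by case: ex_minnP => m /asboolP.
by have /connectP[p pp ->] := e_conn u v; exists (size p); apply/asboolP; exists p.
Qed.

Lemma dist_triangle w u v : dist u v <= dist u w + dist w v.
Proof.
have [p [pp lp <-]] := geodesic u w; have [q [pq lq <-]] := geodesic w v.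
by rewrite -size_cat; apply: dist_min; rewrite ?cat_path ?last_cat lp // pp.
Qed.

Lemma dist0 u : dist u u = 0.
Proof. by apply/eqP; rewrite -leqn0; apply: (@dist_min u u [::]). Qed.

Lemma dist_edge u v : e u v -> dist u v <= 1.
Proof. by move=> uv; apply: (@dist_min u v [:: v]) => //=; rewrite uv. Qed.

Lemma dist_gt0 u v : u != v -> 0 < dist u v.
Proof.
move=> uv; have [[|x p] [_ /= lp <-]] := geodesic u v => //.
by rewrite lp eqxx in uv.
Qed.

Lemma dist_sym : symmetric e -> forall u v, dist u v = dist v u.
Proof.
move=> es; suff le u v : dist u v <= dist v u.
  by move=> u v; apply/eqP; rewrite eqn_leq !le.
have [p [pp lp <-]] := geodesic v u.
rewrite -(size_belast v p) -size_rev; apply: dist_min.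
  by rewrite -lp rev_path (eq_path (e' := e)) // => x y; rewrite es.
by case: p lp {pp} => [|y p] /= lp; [rewrite lp | rewrite rev_cons last_rcons].
Qed.

Lemma dist_on_geodesic u v p w : path e u p -> last u p = v ->
  size p = dist u v -> w \in u :: p -> dist u w + dist w v = dist u v.
Proof.
move=> + + + wp; case/splitPl: wp => p1 p2 lp1.
rewrite cat_path last_cat size_cat lp1 => /andP[pp1 pp2] lp2 sz.
have := dist_min pp1 lp1; have := dist_min pp2 lp2; have := dist_triangle w u v.
lia.
Qed.

Lemma visible_elim X u v : visible e X u v ->
  exists p, [/\ path e u p, last u p = v, size p = dist u v &
    forall w, w \in p -> w \in X -> w = u \/ w = v].
Proof.
move=> [p [[[pp lp up] minp] /subsetP sub]]; exists p; split=> //; last first.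
  move=> w wp wX; have := sub w; rewrite !inE wp wX orbT => /(_ isT).
  by case/orP => /eqP; [left | right].
apply/eqP; rewrite eqn_leq dist_min // andbT.
have [q [pq lq <-]] := geodesic u v; case/shortenP: pq lq => q' pq' uq' sub' lq'.
apply: leq_trans (minp q' _) _; first by split.
by apply: uniq_leq_size => //; case/andP: uq'.
Qed.

(** Cutting loops out of [p] neither lengthens it nor adds vertices, so the spliced walks built
    below need not be simple. *)
Lemma visible_intro X u v p : path e u p -> last u p = v ->
  size p <= dist u v -> (forall w, w \in p -> w \in X -> w = u \/ w = v) ->
  visible e X u v.
Proof.
move=> pp lp; case/shortenP: pp lp => p' pp' up' sub' lp' sz avoid.
have le : size p' <= dist u v.
  by apply: leq_trans sz; apply: uniq_leq_size => //; case/andP: up'.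
exists p'; split.
  by split=> // q [pq lq _]; apply: leq_trans le _; apply: dist_min.
apply/subsetP => w; rewrite !inE => /andP[/orP[->//|wp wX]].
by have [->|->] := avoid w (sub' _ wp) wX; rewrite eqxx ?orbT.
Qed.

Lemma outer_card_mu X : outer_mutual_visibility_set e X -> #|X| <= mu_o e.
Proof.
move=> oX; apply: (leq_bigmax_cond (F := fun X : {set T} => #|X|)).
exact/asboolP.
Qed.

Lemma mu_o_leq n :
  (forall X, outer_mutual_visibility_set e X -> #|X| <= n) -> mu_o e <= n.
Proof. by move=> h; apply/bigmax_leqP => X /asboolP /h. Qed.

Lemma mu_o_gt0 u : 0 < mu_o e.
Proof.
rewrite -(cards1 u); apply: outer_card_mu => x v /set1P->.
have [p [pp lp sp]] := geodesic u v.
by apply: (visible_intro pp lp) => [|w _ /set1P]; [rewrite sp | left].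
Qed.

End Distance.

(** Cuts a walk just after its last vertex in [P], hence the induction from the end of the list. *)
Lemma last_exit (T : Type) (P : pred T) x p : P x -> ~~ P (last x p) ->
  exists p1 y p2, [/\ p = p1 ++ y :: p2, P (last x p1) & ~~ has P (y :: p2)].
Proof.
move=> Px; elim/last_ind: p => [|p z IH]; first by rewrite /= Px.
rewrite last_rcons => Pz; have [Pl|/IH[p1 [y [p2 [-> Pl hP]]]]] := boolP (P (last x p)).
  by exists p, z, [::]; rewrite cats1 /= orbF.
exists p1, y, (rcons p2 z); split=> //; first by rewrite rcons_cat.
by rewrite -rcons_cons has_rcons negb_or Pz.
Qed.

(** * Sides of the edge and the geodesics that cross it *)

Section EdgeDeletion.
(* [e'] is [e] with the edge [ab] removed, described symmetrically in [a] and
   [b] so that the results also apply with [a] and [b] exchanged. *)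
Variables (T : finType) (e e' : rel T) (a b : T).
Hypotheses (e_sym : symmetric e) (e_conn : connected_graph e).
Hypotheses (ab : a != b) (sub : subrel e' e) (e'_conn : connected_graph e').
Hypothesis del : forall x y,
  e x y -> [\/ e' x y, x = a /\ y = b | x = b /\ y = a].
Implicit Types (u v w : T) (p q : seq T) (X Y : {set T}).

Local Notation d := (dist e).
Local Notation d' := (dist e').

Definition side u := d u a < d u b.
Definition opp_side u := d u b < d u a.

Lemma path_del u p : path e u p ->
  path e' u p \/ exists p1 y p2, p = p1 ++ y :: p2 /\
    ((last u p1 = a /\ y = b) \/ (last u p1 = b /\ y = a)).
Proof.
elim: p u => [|z p IH] u /=; first by left.
move=> /andP[uz /IH[pz|[p1 [y [p2 [-> h]]]]]]; last first.
  by right; exists (z :: p1), y, p2.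
by case: (del uz) => [->|h|h]; [left | |]; try (right; exists [::], z, p; auto).
Qed.

(** A geodesic through the edge splits there into two walks; their lengths bound the sum from above,
    and the triangle inequality gives the converse. *)
Lemma geodesic_del u v p : path e u p -> last u p = v -> size p = d u v ->
  [\/ path e' u p, d u v = d u a + 1 + d b v | d u v = d u b + 1 + d a v].
Proof.
move=> pp lp sp; have [?|[p1 [y [p2 [dp h]]]]] := path_del pp.
  by constructor 1.
have dab : d a b <= 1 /\ d b a <= 1.
  rewrite (dist_sym e_conn e_sym b a); split; apply: dist_edge;
  move: pp; rewrite dp cat_path /= => /and3P[_ + _];
  by case: h => -[-> ->]; rewrite // e_sym.
move: pp lp sp; rewrite dp cat_path last_cat size_cat /= => /and3P[p1P _ p2P] lp sp.
have := dist_min p1P erefl; have := dist_min p2P lp.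
case: h => -[l1 dy]; rewrite l1 dy => le2 le1; [constructor 2 | constructor 3].
  have := dist_triangle e_conn a u v; have := dist_triangle e_conn b a v; lia.
have := dist_triangle e_conn b u v; have := dist_triangle e_conn a b v; lia.
Qed.

(** Compare with the triangle inequality through [b] for [u], and through [a] for [v]. *)
Lemma crossing_sides u v : d u v = d u a + 1 + d b v -> side u /\ opp_side v.
Proof.
move=> duv; have := dist_triangle e_conn b u v; have := dist_triangle e_conn a u v.
by rewrite /side /opp_side !(dist_sym e_conn e_sym v); lia.
Qed.

Lemma crossing_sides_rev u v :
  d u v = d u b + 1 + d a v -> opp_side u /\ side v.
Proof.
move=> duv; have := dist_triangle e_conn b u v; have := dist_triangle e_conn a u v.
by rewrite /side /opp_side !(dist_sym e_conn e_sym v); lia.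
Qed.

Lemma side_a : side a.
Proof. by rewrite /side dist0 dist_gt0. Qed.

Lemma opp_side_b : opp_side b.
Proof. by rewrite /opp_side dist0 dist_gt0 // eq_sym. Qed.

Lemma side_opp u : side u -> ~~ opp_side u.
Proof. by rewrite /side /opp_side -leqNgt => /ltnW. Qed.

Lemma opp_side_side u : opp_side u -> ~~ side u.
Proof. by rewrite /side /opp_side -leqNgt => /ltnW. Qed.

Lemma geodesic_avoids u v p : ~~ (side u && opp_side v) ->
  ~~ (opp_side u && side v) ->
  path e u p -> last u p = v -> size p = d u v -> path e' u p.
Proof.
move=> h1 h2 pp lp sp; case: (geodesic_del pp lp sp) => //.
  by move=> /crossing_sides[u1 v1]; rewrite u1 v1 in h1.
by move=> /crossing_sides_rev[u1 v1]; rewrite u1 v1 in h2.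
Qed.

Lemma leq_dist_del u v : d u v <= d' u v.
Proof.
have [p [pp lp <-]] := geodesic e'_conn u v.
by apply: dist_min => //; apply: sub_path pp.
Qed.

Lemma dist_del_eq u v : ~~ (side u && opp_side v) ->
  ~~ (opp_side u && side v) -> d' u v = d u v.
Proof.
move=> h1 h2; apply/eqP; rewrite eqn_leq leq_dist_del andbT.
have [p [pp lp sp]] := geodesic e_conn u v; rewrite -sp.
by apply: dist_min => //; apply: geodesic_avoids pp lp sp.
Qed.

Lemma opp_side_between v w : opp_side v -> d b w + d w v = d b v -> opp_side w.
Proof.
rewrite /opp_side !(dist_sym e_conn e_sym _ a) !(dist_sym e_conn e_sym _ b).
by have := dist_triangle e_conn w a v; lia.
Qed.

(** * From G - ab to G *)

(** Visibility allows the path from [x] to [a] to meet [X] at its end [a], so [Y] must omit [a]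
    before [b :: q] is appended. *)
Lemma visible_crossing X Y x v q : outer_mutual_visibility_set e' X ->
  Y \subset X -> a \notin Y -> x \in Y -> d x v = d x a + 1 + d b v ->
  e a b -> path e b q -> last b q = v -> size q = d b v ->
  (forall w, w \in b :: q -> w \in Y -> w = v) -> visible e Y x v.
Proof.
move=> oX /subsetP YX aY xY dxv eab pq lq sq avq.
have [sx sv] := crossing_sides dxv.
have [p [pp lp sp avp]] := visible_elim e'_conn (oX x a (YX _ xY)).
have dxa : d' x a = d x a.
  by apply: dist_del_eq; rewrite (negPf (side_opp _)) ?side_a // andbF.
apply: (@visible_intro _ _ _ _ _ (p ++ b :: q)).
- by rewrite cat_path /= lp eab pq (sub_path sub pp).
- by rewrite last_cat.
- by rewrite size_cat /= sp sq; lia.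
move=> w; rewrite mem_cat => /orP[wp wY|wq wY]; last by right; apply: avq.
by have [->|wa] := avp w wp (YX _ wY); [left | rewrite wa (negPf aY) in wY].
Qed.

Lemma visible_undel X Y x v : outer_mutual_visibility_set e' X ->
  Y \subset X -> x \in Y ->
  [\/ visible e Y x v, d x v = d x a + 1 + d b v | d x v = d x b + 1 + d a v].
Proof.
move=> oX YX xY; have [q [pq lq sq]] := geodesic e_conn x v.
case: (geodesic_del pq lq sq) => [pq'|h|h]; last 2 first.
- by constructor 2.
- by constructor 3.
constructor 1; move/subsetP: YX => YX.
have [p [pp lp sp avp]] := visible_elim e'_conn (oX x v (YX _ xY)).
apply: (visible_intro (sub_path sub pp) lp) => [|w wp /YX]; last exact: avp.
by rewrite sp -sq; apply: dist_min.
Qed.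

Lemma outer_undel_side X : e a b -> outer_mutual_visibility_set e' X ->
  outer_mutual_visibility_set e [set x in X | ~~ opp_side x & x != a].
Proof.
move=> eab oX x v xY; set Y := [set x in X | _] in xY *.
have YX : Y \subset X by apply/subsetP => w; rewrite inE => /andP[].
case: (visible_undel v oX YX xY) => // h; last first.
  by have [ox _] := crossing_sides_rev h; move: xY; rewrite inE ox andbF.
have [sx ov] := crossing_sides h.
have [q [pq lq sq]] := geodesic e_conn b v.
apply: (visible_crossing oX YX _ xY h eab pq lq sq).
  by rewrite inE eqxx !andbF.
move=> w wq; rewrite inE.
by rewrite (opp_side_between ov (dist_on_geodesic e_conn pq lq sq wq)) andbF.
Qed.

(** Here [Y] may meet the b-side, so the second half of the path comes from the visibility of [v]
    from [b]. *)
Lemma visible_undel_ends X x v : e a b -> outer_mutual_visibility_set e' X ->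
  b \in X -> x \in X :\: [set a; b] -> d x v = d x a + 1 + d b v ->
  visible e (X :\: [set a; b]) x v.
Proof.
move=> eab oX bX xY h; have [sx ov] := crossing_sides h.
have [q [pq lq sq avq]] := visible_elim e'_conn (oX b v bX).
apply: (visible_crossing oX (subsetDl _ _) _ xY h eab (sub_path sub pq) lq).
- by rewrite !inE eqxx.
- rewrite sq; apply: dist_del_eq;
    by rewrite (negPf (opp_side_side _)) ?opp_side_b // andbF.
move=> w; rewrite !inE negb_or => /orP[/eqP->|wq /andP[/andP[_ wb] wX]].
  by rewrite eqxx andbF.
by have [wb'|//] := avq w wq wX; rewrite wb' eqxx in wb.
Qed.

(** * From G to G - ab *)

Lemma visible_del X Y x v : outer_mutual_visibility_set e X -> Y \subset X ->
  x \in Y ->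
  [\/ visible e' Y x v, d x v = d x a + 1 + d b v | d x v = d x b + 1 + d a v].
Proof.
move=> oX /subsetP YX xY.
have [p [pp lp sp avp]] := visible_elim e_conn (oX x v (YX _ xY)).
case: (geodesic_del pp lp sp) => [pp'|h|h]; last 2 first.
- by constructor 2.
- by constructor 3.
constructor 1; apply: (visible_intro pp' lp) => [|w wp /YX]; last exact: avp.
by rewrite sp leq_dist_del.
Qed.

Lemma outer_del_balanced X : outer_mutual_visibility_set e X ->
  outer_mutual_visibility_set e' [set x in X | d x a == d x b].
Proof.
move=> oX x v xY; set Y := [set x in X | _] in xY *.
have YX : Y \subset X by apply/subsetP => w; rewrite inE => /andP[].
move: (xY); rewrite inE => /andP[_ xab].
case: (visible_del v oX YX xY) => // [/crossing_sides|/crossing_sides_rev] [];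
  by rewrite /side /opp_side (eqP xab) ltnn.
Qed.

Lemma outer_del_frontier X : outer_mutual_visibility_set e X ->
  outer_mutual_visibility_set e'
    [set x in X | side x & [exists y, e' x y && opp_side y]].
Proof.
move=> oX x v xY; set Y := [set x in X | _] in xY *.
have YX : Y \subset X by apply/subsetP => w; rewrite inE => /andP[].
move: (xY); rewrite inE => /and3P[_ sx /existsP[y /andP[xy oy]]].
case: (visible_del v oX YX xY) => // [h|/crossing_sides_rev[ox _]]; last first.
  by have := side_opp sx; rewrite ox.
have [_ ov] := crossing_sides h.
have [p [pp lp sp]] := geodesic e_conn y b.
have [q [pq lq sq]] := geodesic e_conn b v.
have pp' : path e' y p.
  apply: geodesic_avoids pp lp sp;
    by rewrite (negPf (opp_side_side _)) ?opp_side_b // andbF.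
have pq' : path e' b q.
  apply: geodesic_avoids pq lq sq;
    by rewrite (negPf (opp_side_side _)) ?opp_side_b // andbF.
have notY w : opp_side w -> w \in Y -> w = x \/ w = v.
  by move=> /opp_side_side sw; rewrite inE (negPf sw) andbF.
apply: (@visible_intro _ _ _ _ _ (y :: p ++ q)).
- by rewrite /= xy cat_path pp' lp.
- by rewrite /= last_cat lp.
(* Since d y b < d y a <= 1 + d x a, the detour through [y] has length 1 + d y b + d b v <= d x
   v. *)
- rewrite /= size_cat sp sq; apply: leq_trans (leq_dist_del x v); rewrite h.
  rewrite -addSn leq_add2r addn1 ltnS -ltnS; apply: leq_trans oy _.
  apply: leq_trans (dist_triangle e_conn x y a) _; rewrite -add1n leq_add2r.
  by rewrite (dist_sym e_conn e_sym); apply/dist_edge/sub.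
move=> w; rewrite -cat_cons mem_cat => /orP[wp|wq]; apply: notY.
  apply: (opp_side_between oy); rewrite !(dist_sym e_conn e_sym _ y).
  rewrite (dist_sym e_conn e_sym b w) addnC.
  exact: (dist_on_geodesic e_conn pp lp sp wp).
apply: (opp_side_between ov); apply: (dist_on_geodesic e_conn pq lq sq).
by rewrite inE wq orbT.
Qed.

Lemma outer_del_interior X : outer_mutual_visibility_set e X ->
  outer_mutual_visibility_set e'
    [set x in X | side x & ~~ [exists y, e' x y && opp_side y]].
Proof.
move=> oX x v xY; set Y := [set x in X | _] in xY *.
have YX : Y \subset X by apply/subsetP => w; rewrite inE => /andP[].
move: (xY); rewrite inE => /and3P[xX sx _].
case: (visible_del v oX YX xY) => // [h|/crossing_sides_rev[ox _]]; last first.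
  by have := side_opp sx; rewrite ox.
have [_ ov] := crossing_sides h.
have [P [PP lP sP]] := geodesic e'_conn x v.
have [|p1 [y [p2 [dP sw nh]]]] := @last_exit _ side x P sx.
  by rewrite lP opp_side_side.
have notY z : z \in y :: p2 -> z \in Y -> z = x \/ z = v.
  by move=> zp; rewrite inE (negPf (hasPn nh z zp)) andbF.
move: PP lP sP; rewrite dP cat_path last_cat size_cat /=.
set w := last x p1 in sw * => /and3P[pp1 wy pp2] lp2 sz.
have sub_vis z : z \notin Y -> ~~ opp_side z ->
  exists r, [/\ path e' x r, last x r = z, size r = d x z &
    forall t, t \in r -> t \in Y -> t = x].
  move=> zY oz; have [r [pr lr sr avr]] := visible_elim e_conn (oX x z xX).
  exists r; split=> // [|t tr tY].
    apply: geodesic_avoids pr lr sr; first by rewrite negb_and oz orbT.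
    by rewrite negb_and side_opp.
  have [//|tz] := avr t tr (subsetP YX _ tY).
  by rewrite tz (negPf zY) in tY.
have pp1e := sub_path sub pp1.
(* If [y] is on the b-side, [w] has a neighbour there and is outside [Y]; otherwise [y] is balanced
   and itself serves as the switching vertex. *)
have [oy|oy] := boolP (opp_side y).
  have [||r [pr lr sr avr]] := sub_vis w.
  - rewrite inE; apply/negP => /and3P[_ _ /existsP[]].
    by exists y; rewrite wy oy.
  - exact: side_opp.
  apply: (@visible_intro _ _ _ _ _ (r ++ y :: p2)).
  - by rewrite cat_path /= lr pr wy pp2.
  - by rewrite last_cat.
  - by rewrite size_cat /= sr -sz leq_add2r; apply: dist_min.
  move=> t; rewrite mem_cat => /orP[tr tY|]; last exact: notY.
  by left; apply: avr tY.
have [|r [pr lr sr avr]] := sub_vis y _ oy.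
  by move: nh => /= /norP[sy _]; rewrite inE (negPf sy) andbF.
apply: (@visible_intro _ _ _ _ _ (r ++ p2)).
- by rewrite cat_path lr pr.
- by rewrite last_cat lr.
- rewrite size_cat sr -sz addnS -addSn leq_add2r -(size_rcons _ y).
  by apply: dist_min; rewrite ?last_rcons // rcons_path pp1e; apply: sub.
move=> t; rewrite mem_cat => /orP[tr tY|tp].
  by left; apply: avr tY.
by apply: notY; rewrite inE tp orbT.
Qed.

Lemma card_side_leq X : outer_mutual_visibility_set e X ->
  #|[set x in X | side x]| <= 2 * mu_o e'.
Proof.
move=> oX; have := outer_card_mu (outer_del_frontier oX).
have := outer_card_mu (outer_del_interior oX).
set Y1 := [set x in X | _ & _]; set Y2 := [set x in X | _ & _] => h1 h2.
apply: (@leq_trans (#|Y1| + #|Y2|)); last by lia.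
apply: leq_trans (leq_card_setU _ _); apply: subset_leq_card.
by apply/subsetP => x; rewrite !inE => /andP[-> ->] /=; rewrite orNb.
Qed.

End EdgeDeletion.

(** * The two bounds *)

Section Bounds.
Variables (T : finType) (e e' : rel T) (a b : T).
Hypotheses (e_sym : symmetric e) (e_conn : connected_graph e).
Hypotheses (ab : a != b) (eab : e a b).
Hypotheses (sub : subrel e' e) (e'_conn : connected_graph e').
Hypothesis del : forall x y,
  e x y -> [\/ e' x y, x = a /\ y = b | x = b /\ y = a].

Let ba : b != a. Proof. by rewrite eq_sym. Qed.
Let eba : e b a. Proof. by rewrite e_sym. Qed.
Let del_swap x y : e x y -> [\/ e' x y, x = b /\ y = a | x = a /\ y = b].
Proof. by case/del; [constructor 1 | constructor 3 | constructor 2]. Qed.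

(** 5 = 2 + 2 + 1: two sets for each strict side and one for the balanced vertices. *)
Lemma mu_o_leq_del : mu_o e <= 5 * mu_o e'.
Proof.
apply: mu_o_leq => X oX.
have hA := card_side_leq e_sym e_conn ab sub e'_conn del oX.
have hB := card_side_leq e_sym e_conn ba sub e'_conn del_swap oX.
have hC := outer_card_mu (outer_del_balanced e_sym e_conn ab sub e'_conn del oX).
move: hA hB hC; set A := [set x in X | side _ _ _ _].
set B := [set x in X | side _ _ _ _]; set C := [set x in X | _] => hA hB hC.
have : #|X| <= #|A :|: B :|: C|.
  apply: subset_leq_card; apply/subsetP => x xX; rewrite !inE xX /side /=.
  by case: ltngtP.
have [+ _] := leq_card_setU (A :|: B) C; have [+ _] := leq_card_setU A B; lia.
Qed.

Lemma mu_o_del_leq : mu_o e' <= 2 * mu_o e + 1.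
Proof.
apply: mu_o_leq => X oX.
have mu1 := mu_o_gt0 e_conn a.
have hA := outer_card_mu (outer_undel_side e_sym e_conn ab sub e'_conn del eab oX).
have hB := outer_card_mu
  (outer_undel_side e_sym e_conn ba sub e'_conn del_swap eba oX).
move: hA hB; set A := [set x in X | _ & _]; set B := [set x in X | _ & _] => hA hB.
(* The summand 1 pays for the single vertex [c] missed by both sets. If [a] is not in [X], only [b]
   can be missed, and conversely. *)
have cov c : X \subset A :|: B :|: [set c] -> #|X| <= 2 * mu_o e + 1.
  move=> /subset_leq_card; have [+ _] := leq_card_setU (A :|: B) [set c].
  by have [+ _] := leq_card_setU A B; rewrite cards1; lia.
have sides x : ~~ opp_side e a b x || ~~ opp_side e b a x.
  by rewrite /opp_side; case: ltngtP.
have [aX|aX] := boolP (a \in X); last first.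
  apply: (cov b); apply/subsetP => x xX; rewrite !inE xX /=.
  have -> : x != a by apply: contraNneq aX => <-.
  by have := sides x; case: (x == b); rewrite ?orbT // !andbT orbF.
have [bX|bX] := boolP (b \in X); last first.
  apply: (cov a); apply/subsetP => x xX; rewrite !inE xX /=.
  have -> : x != b by apply: contraNneq bX => <-.
  by have := sides x; case: (x == a); rewrite ?orbT // !andbT orbF.
have oY : outer_mutual_visibility_set e (X :\: [set a; b]).
  move=> x v xY.
  case: (visible_undel e_sym e_conn ab sub e'_conn del v oX (subsetDl _ _) xY) => //.
    exact: (visible_undel_ends e_sym e_conn ab sub e'_conn del eab oX bX xY).
  rewrite setUC in xY *.
  exact: (visible_undel_ends e_sym e_conn ba sub e'_conn del_swap eba oX aX xY).
(* Removing both ends gives #|X| <= [mu_o e] + 2, which suffices because [mu_o e] >= 1. *)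
have := outer_card_mu oY; have := cardsID [set a; b] X.
have := subset_leq_card (subsetIr X [set a; b]); rewrite cards2 ab /=; lia.
Qed.

End Bounds.

Lemma del_edge_cases (T : finType) (adj : rel T) (a b x y : T) : adj x y ->
  [\/ del_edge adj a b x y, x = a /\ y = b | x = b /\ y = a].
Proof.
rewrite /del_edge /= => xy; rewrite xy /=.
have [E|_] := eqVneq [set x; y] [set a; b]; last by constructor 1.
have : x \in [set a; b] by rewrite -E set21.
have : y \in [set a; b] by rewrite -E set22.
have : a \in [set x; y] by rewrite E set21.
have : b \in [set x; y] by rewrite E set22.
move=> /set2P bE /set2P aE /set2P yE /set2P[xa|xb].
  by constructor 2; split=> //; case: bE => bE; case: yE => yE; congruence.
by constructor 3; split=> //; case: aE => aE; case: yE => yE; congruence.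
Qed.

Theorem theorem3p3 (T : finType) (adj : rel T) (a b : T)
    (adj_sym : symmetric adj) (adj_irr : irreflexive adj)
    (adj_conn : connected_graph adj) (edge_ab : adj a b)
    (del_conn : connected_graph (del_edge adj a b)) :
  (6%:R^-1 * (mu_o adj)%:R <= (mu_o (del_edge adj a b))%:R :> rat)%R /\
  (mu_o (del_edge adj a b) <= 2 * mu_o adj + 1)%N.
Proof.
have ab : a != b by apply: contraTneq edge_ab => ->; rewrite adj_irr.
have sub : subrel (del_edge adj a b) adj by move=> x y /andP[].
have del x y := @del_edge_cases T adj a b x y.
split; last exact: mu_o_del_leq adj_sym adj_conn ab edge_ab sub del_conn del.
rewrite GRing.mulrC Num.Theory.ler_pdivrMr // -GRing.natrM Num.Theory.ler_nat.
(* The factor 5 is stronger than the required 6. *)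
have := mu_o_leq_del adj_sym adj_conn ab edge_ab sub del_conn del; lia.
Qed.
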